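(* Let $a=(a_1,0)\in\mathbb{R}^2$ with $a_1\in[0,1)$, and define two Minkowski norms on $\mathbb{R}^2$ by $$\psi(y)=\phi(y):=|y|+\langle a,y\rangle .$$ Let $\Omega:=\{x\in\mathbb{R}^2:\phi(x)<1\}$, let $P=P(x,y)$ be the unique solution of $P=\phi(y+xP)$ for $(x,y)\in\Omega\times\mathbb{R}^2$, define $$F(x,y):=\psi(y+xP(x,y))\,\{1+x^kP_{y^k}(x,y)\},\quad (x,y)\in\Omega\times\mathbb{R}^2,$$ and let $\mathscr O:=\{x\in\Omega: F(x,\cdot)\text{ is a Minkowski norm}\}$. Then $\mathscr O$ exhibits three distinct configurations within $\Omega$: (1) if $a_1\in[0,\frac{2\sqrt2}{3})$, then $\mathscr O=\Omega$; (2) if $a_1=\frac{2\sqrt2}{3}$, then $\mathscr O=\Omega\setminus\{(x_1,x_2): x_1=-\frac{3\sqrt2}{2}\}$; (3) if $a_1\in(\frac{2\sqrt2}{3},1)$, then $$\mathscr O=\Omega\cap\left\{(x_1,x_2):\ 8(1-a_1^2)\Big(x_1+\frac{a_1}{4(1-a_1^2)}\Big)^2-(9a_1^2-8)x_2^2>\frac{9a_1^2-8}{2(1-a_1^2)}\right\}.$$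
   Context: $|\cdot|$ and $\langle\cdot,\cdot\rangle$ are the Euclidean norm and inner product; $x=(x_1,x_2)$; repeated indices are summed and $P_{y^k}=\partial P/\partial y^k$. A Minkowski norm on $\mathbb{R}^2$ is a function $\psi\ge 0$, vanishing only at $\mathbf 0$, with $\psi(\alpha y)=\alpha\psi(y)$ for $\alpha>0$, smooth on $\mathbb{R}^2\setminus\{\mathbf 0\}$, such that the matrix $([\psi^2]_{y^iy^j}(y))$ is positive definite for every $y\ne\mathbf 0$. *)

(* Defs.v *)
From Stdlib Require Import Reals.
From Coquelicot Require Import Coquelicot.
Open Scope R_scope.

(** Points and vectors of the plane are given by their two coordinates, and
    functions on the plane are curried, as in Coquelicot's [Derive_2d]. *)

(** [ex_diff_n f n u v] states that all iterated partial derivatives of [f] of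
    order at most [n] exist and are continuous at [(u, v)]. *)
Definition smooth_off_origin (f : R -> R -> R) : Prop :=
  forall (n : nat) (u v : R), (u, v) <> (0, 0) -> ex_diff_n f n u v.

(** For the functions considered here the Hessian is symmetric (they are
    smooth near [(u, v)]), so both mixed entries are [partial_derive 1 1]. *)
Definition hessian_posdef (f : R -> R -> R) (u v : R) : Prop :=
  forall w1 w2 : R, (w1, w2) <> (0, 0) ->
    0 < partial_derive 2 0 f u v * w1 ^ 2
        + 2 * partial_derive 1 1 f u v * (w1 * w2)
        + partial_derive 0 2 f u v * w2 ^ 2.

Record minkowski_norm (psi : R -> R -> R) : Prop := {
  minkowski_nonneg : forall y1 y2, 0 <= psi y1 y2;
  minkowski_eq0 : forall y1 y2, psi y1 y2 = 0 <-> (y1, y2) = (0, 0);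
  minkowski_homog : forall alpha y1 y2, 0 < alpha ->
    psi (alpha * y1) (alpha * y2) = alpha * psi y1 y2;
  minkowski_smooth : smooth_off_origin psi;
  minkowski_convex : forall y1 y2, (y1, y2) <> (0, 0) ->
    hessian_posdef (fun u v => psi u v ^ 2) y1 y2
}.

Definition randers (a1 a2 y1 y2 : R) : R :=
  sqrt (y1 ^ 2 + y2 ^ 2) + (a1 * y1 + a2 * y2).

Definition Omega (phi : R -> R -> R) (x1 x2 : R) : Prop := phi x1 x2 < 1.

(** The unique [p] with [p = phi (y + p x)]; [iota] is Coquelicot's definite
    description, meaningful when such a [p] exists and is unique, as is the
    case for [x] in [Omega phi]. *)
Definition solP (phi : R -> R -> R) (x1 x2 y1 y2 : R) : R :=
  iota (fun p : R => p = phi (y1 + x1 * p) (y2 + x2 * p)).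

(** At [y = 0] the partial derivatives of [solP] in [y] need not exist; since
    [solP] vanishes there, so does the first factor, whatever the values
    [Derive] returns. *)
Definition metricF (psi phi : R -> R -> R) (x1 x2 y1 y2 : R) : R :=
  let p := solP phi x1 x2 y1 y2 in
  psi (y1 + x1 * p) (y2 + x2 * p)
  * (1 + (x1 * Derive (fun t => solP phi x1 x2 t y2) y1
          + x2 * Derive (fun t => solP phi x1 x2 y1 t) y2)).

Definition minkowski_locus (psi phi : R -> R -> R) (x1 x2 : R) : Prop :=
  Omega phi x1 x2 /\ minkowski_norm (metricF psi phi x1 x2).

(* Main.v *)
Require Import Defs.
From Stdlib Require Import Reals Lra.
From Coquelicot Require Import Coquelicot.
Open Scope R_scope.

(** Write [l = 1 - a x1] and [A = l^2 - |x|^2]. Squaring the equation for [P]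
    gives [P = (S + B) / A], where [S = sqrt q] for a positive definite
    quadratic form [q] in [y] with [det q = A], and [B] is linear in [y].
    With [M y = q (x, y)] this yields
    [F = (S + B) (l S + M) / (A^2 S) = (l S + (l B + M) + B M / S) / A^2].
    The linear term does not contribute to the Hessian of [F], which is
    [R / (A S^5)] times the square of [w |-> w1 y2 - w2 y1], with
    [R = (3 l - 2 A) q - 3 B M]. So [F] is a Minkowski norm iff the quadratic
    form [R] is positive definite; its determinant is
    [A^2 / 4 * ((2 + a x1)^2 - (9 a^2 - 8) |x|^2)] and its trace relative to [q]
    is [3 l - A > 0], so only the sign of the last factor matters. *)

(** * Neighbourhoods in the punctured plane *)

Lemma continuity_2d_pt_nonzero_loc (f : R -> R -> R) (P : R -> R -> Prop) (u v : R) :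
  continuity_2d_pt f u v -> f u v <> 0 ->
  (forall s t, f s t <> 0 -> P s t) -> locally_2d P u v.
Proof.
  intros Hc Hn HP.
  apply (locally_2d_impl (fun s t => f s t <> 0)).
  - apply locally_2d_forall; exact HP.
  - now apply continuity_2d_pt_neq_0.
Qed.

(** Lets identities known only off the origin be differentiated there: the nonvanishing of
    [s^2 + t^2] is an open condition. *)
Lemma nonorigin_loc (P : R -> R -> Prop) (u v : R) :
  (u, v) <> (0, 0) -> (forall s t, (s, t) <> (0, 0) -> P s t) ->
  locally_2d P u v.
Proof.
  intros Hn HP.
  apply (continuity_2d_pt_nonzero_loc (fun s t => s * s + t * t)).
  - apply continuity_2d_pt_plus; apply continuity_2d_pt_mult;
      first [apply continuity_2d_pt_id1 | apply continuity_2d_pt_id2].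
  - intros H. apply Hn. f_equal; nra.
  - intros s t H. apply HP. intros E. injection E as -> ->. apply H. ring.
Qed.

(** * Binary quadratic forms and expressions in their square roots *)

Record qform := QForm { q11 : R; q12 : R; q22 : R }.

Definition qeval (q : qform) (u v : R) : R :=
  q11 q * u ^ 2 + 2 * q12 q * (u * v) + q22 q * v ^ 2.

Definition qpos (q : qform) : Prop :=
  forall u v, (u, v) <> (0, 0) -> 0 < qeval q u v.

Definition qdet (q : qform) : R := q11 q * q22 q - q12 q ^ 2.

(** Sylvester's criterion in dimension two, by completing the square after multiplication by
    [q11 q]. *)
Lemma qpos_iff (q : qform) : qpos q <-> 0 < q11 q /\ 0 < qdet q.
Proof.
  unfold qpos, qeval, qdet. split.
  - intros H.
    assert (H1 : 0 < q11 q).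
    { assert (E : (1, 0) <> (0, 0)) by (intros E; injection E; lra).
      specialize (H _ _ E). nra. }
    split; [exact H1|].
    (* At this vector the form takes the value [q11 q * qdet q]. *)
    assert (E : (- q12 q, q11 q) <> (0, 0)) by (intros E; injection E; lra).
    specialize (H _ _ E).
    apply Rmult_lt_reg_l with (q11 q); [exact H1|]. nra.
  - intros [H1 H2] u v Hn.
    apply Rmult_lt_reg_l with (q11 q); [exact H1|].
    rewrite Rmult_0_r.
    replace (q11 q * (q11 q * u ^ 2 + 2 * q12 q * (u * v) + q22 q * v ^ 2))
      with ((q11 q * u + q12 q * v) ^ 2 + (q11 q * q22 q - q12 q ^ 2) * v ^ 2) by ring.
    destruct (Req_dec v 0) as [->|Hv].
    + assert (u <> 0) by (intros ->; now apply Hn).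
      assert (0 < u ^ 2) by now apply pow2_gt_0.
      assert (0 < q11 q ^ 2) by nra. nra.
    + assert (0 < v ^ 2) by now apply pow2_gt_0.
      assert (0 <= (q11 q * u + q12 q * v) ^ 2) by apply pow2_ge_0. nra.
Qed.

(** The polynomials in [u], [v], [sqrt q] and [/ sqrt q] are stable under
    differentiation, hence smooth off the origin. *)
Inductive expr :=
| Const (r : R) | Fst | Snd | Root | InvRoot
| Plus (e f : expr) | Times (e f : expr).

Fixpoint eval (q : qform) (e : expr) (u v : R) : R :=
  match e with
  | Const r => r
  | Fst => u
  | Snd => v
  | Root => sqrt (qeval q u v)
  | InvRoot => / sqrt (qeval q u v)
  | Plus e f => eval q e u v + eval q f u v
  | Times e f => eval q e u v * eval q f u v
  end.

Definition linear (a b : R) : expr := Plus (Times (Const a) Fst) (Times (Const b) Snd).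

(** Half the derivative of [qeval q] in the direction [(h, k)]; the half absorbs the factor 2 from
    differentiating a square root. *)
Definition qpolar (q : qform) (h k : R) : expr :=
  linear (q11 q * h + q12 q * k) (q12 q * h + q22 q * k).

(** The formal derivative in the direction [(h, k)]. It is shown to be the true one only off the
    origin, where the root does not vanish. *)
Fixpoint diff (q : qform) (h k : R) (e : expr) : expr :=
  match e with
  | Const _ => Const 0
  | Fst => Const h
  | Snd => Const k
  | Root => Times (qpolar q h k) InvRoot
  | InvRoot =>
      Times (Times (Const (-1)) (qpolar q h k)) (Times InvRoot (Times InvRoot InvRoot))
  | Plus e f => Plus (diff q h k e) (diff q h k f)
  | Times e f => Plus (Times (diff q h k e) f) (Times e (diff q h k f))
  end.

(** * Derivatives, continuity and smoothness of expressions off the origin *)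

Section Expressions.

Context (q : qform) (Hq : qpos q).

Lemma sqrt_qeval_pos (u v : R) : (u, v) <> (0, 0) -> 0 < sqrt (qeval q u v).
Proof. intros H. apply sqrt_lt_R0. now apply Hq. Qed.

(** Stated along a curve with velocity [(h, k)], so that a single induction yields both partial
    derivatives. *)
Lemma is_derive_eval (e : expr) (x y : R -> R) (t h k : R) :
  (x t, y t) <> (0, 0) -> is_derive x t h -> is_derive y t k ->
  is_derive (fun s => eval q e (x s) (y s)) t (eval q (diff q h k e) (x t) (y t)).
Proof.
  intros Hn Hx Hy.
  assert (HQ : is_derive (fun s => qeval q (x s) (y s)) t
                 (2 * eval q (qpolar q h k) (x t) (y t))).
  { unfold qeval. auto_derive.
    - repeat split; eexists; eassumption.
    - replace (Derive (fun z => x z) t) with h by (symmetry; now apply is_derive_unique).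
      replace (Derive (fun z => y z) t) with k by (symmetry; now apply is_derive_unique).
      unfold qpolar, linear; simpl. ring. }
  pose proof (sqrt_qeval_pos _ _ Hn) as Hs.
  assert (HR : is_derive (fun s => sqrt (qeval q (x s) (y s))) t
                 (eval q (diff q h k Root) (x t) (y t))).
  { replace (eval q (diff q h k Root) (x t) (y t))
      with (2 * eval q (qpolar q h k) (x t) (y t) / (2 * sqrt (qeval q (x t) (y t)))).
    - exact (is_derive_sqrt _ _ _ HQ (Hq _ _ Hn)).
    - cbn [diff eval]. field. lra. }
  induction e as [r| | | | |e IHe f IHf|e IHe f IHf].
  - exact (is_derive_const r t).
  - exact Hx.
  - exact Hy.
  - exact HR.
  - replace (eval q (diff q h k InvRoot) (x t) (y t))
      with (- eval q (diff q h k Root) (x t) (y t) / sqrt (qeval q (x t) (y t)) ^ 2).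
    + apply (is_derive_inv _ _ _ HR). lra.
    + cbn [diff eval]. field. lra.
  - exact (is_derive_plus _ _ _ _ _ IHe IHf).
  - exact (is_derive_mult _ _ _ _ _ IHe IHf Rmult_comm).
Qed.

Lemma is_derive_eval_l (e : expr) (u v : R) :
  (u, v) <> (0, 0) -> is_derive (fun s => eval q e s v) u (eval q (diff q 1 0 e) u v).
Proof.
  intros Hn. apply (is_derive_eval e (fun s => s) (fun _ => v)).
  - exact Hn.
  - exact (is_derive_id u).
  - exact (is_derive_const v u).
Qed.

Lemma is_derive_eval_r (e : expr) (u v : R) :
  (u, v) <> (0, 0) -> is_derive (fun s => eval q e u s) v (eval q (diff q 0 1 e) u v).
Proof.
  intros Hn. apply (is_derive_eval e (fun _ => u) (fun s => s)).
  - exact Hn.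
  - exact (is_derive_const u v).
  - exact (is_derive_id v).
Qed.

Lemma continuity_2d_pt_eval (e : expr) (u v : R) :
  (u, v) <> (0, 0) -> continuity_2d_pt (eval q e) u v.
Proof.
  intros Hn.
  assert (Hs : continuity_2d_pt (fun s t => sqrt (qeval q s t)) u v).
  { apply (continuity_1d_2d_pt_comp sqrt).
    - apply continuity_pt_sqrt. now apply Rlt_le, Hq.
    - apply (continuity_2d_pt_ext
        (fun s t => q11 q * (s * s) + 2 * q12 q * (s * t) + q22 q * (t * t))).
      + intros s t. unfold qeval. ring.
      + repeat first [ apply continuity_2d_pt_plus | apply continuity_2d_pt_mult
                     | apply continuity_2d_pt_const | apply continuity_2d_pt_id1
                     | apply continuity_2d_pt_id2 ]. }
  induction e as [r| | | | |e IHe f IHf|e IHe f IHf].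
  - apply continuity_2d_pt_const.
  - apply continuity_2d_pt_id1.
  - apply continuity_2d_pt_id2.
  - exact Hs.
  - apply continuity_2d_pt_inv; [exact Hs|].
    pose proof (sqrt_qeval_pos _ _ Hn). lra.
  - now apply continuity_2d_pt_plus.
  - now apply continuity_2d_pt_mult.
Qed.

(** Induction on the order for all expressions at once, because the partial derivatives of an
    expression are again expressions. *)
Lemma smooth_eval (e : expr) : smooth_off_origin (eval q e).
Proof.
  intros n. revert e. induction n as [|n IH]; intros e u v Hn.
  - split; [now apply continuity_2d_pt_eval|exact I].
  - split; [now apply continuity_2d_pt_eval|]. repeat split.
    + eexists. now apply is_derive_eval_l.
    + eexists. now apply is_derive_eval_r.
    + apply (ex_diff_n_ext_loc (eval q (diff q 1 0 e))); [|now apply IH].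
      apply nonorigin_loc; [exact Hn|]. intros s t Hst.
      symmetry. apply is_derive_unique. now apply is_derive_eval_l.
    + apply (ex_diff_n_ext_loc (eval q (diff q 0 1 e))); [|now apply IH].
      apply nonorigin_loc; [exact Hn|]. intros s t Hst.
      symmetry. apply is_derive_unique. now apply is_derive_eval_r.
Qed.

(** The inner derivative agrees with [diff] on a whole neighbourhood, as a second differentiation
    requires. *)
Lemma partial_derive_eval_20 (e : expr) (u v : R) :
  (u, v) <> (0, 0) ->
  partial_derive 2 0 (eval q e) u v = eval q (diff q 1 0 (diff q 1 0 e)) u v.
Proof.
  intros Hn. apply is_derive_unique.
  apply (is_derive_ext_loc (fun s => eval q (diff q 1 0 e) s v)).
  - apply (locally_2d_1d_const_y (fun s t => eval q (diff q 1 0 e) s t =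
        Derive_n (fun s => Derive_n (fun z => eval q e s z) 0 t) 1 s)).
    apply nonorigin_loc; [exact Hn|]. intros s t Hst.
    symmetry. apply is_derive_unique. now apply is_derive_eval_l.
  - now apply is_derive_eval_l.
Qed.

Lemma partial_derive_eval_11 (e : expr) (u v : R) :
  (u, v) <> (0, 0) ->
  partial_derive 1 1 (eval q e) u v = eval q (diff q 1 0 (diff q 0 1 e)) u v.
Proof.
  intros Hn. apply is_derive_unique.
  apply (is_derive_ext_loc (fun s => eval q (diff q 0 1 e) s v)).
  - apply (locally_2d_1d_const_y (fun s t => eval q (diff q 0 1 e) s t =
        Derive_n (fun z => eval q e s z) 1 t)).
    apply nonorigin_loc; [exact Hn|]. intros s t Hst.
    symmetry. apply is_derive_unique. now apply is_derive_eval_r.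
  - now apply is_derive_eval_l.
Qed.

Lemma partial_derive_eval_02 (e : expr) (u v : R) :
  (u, v) <> (0, 0) ->
  partial_derive 0 2 (eval q e) u v = eval q (diff q 0 1 (diff q 0 1 e)) u v.
Proof.
  intros Hn. apply is_derive_unique.
  apply (is_derive_ext_loc (fun s => eval q (diff q 0 1 e) u s)).
  - apply (locally_2d_1d_const_x (fun s t => eval q (diff q 0 1 e) s t =
        Derive_n (fun z => eval q e s z) 1 t)).
    apply nonorigin_loc; [exact Hn|]. intros s t Hst.
    symmetry. apply is_derive_unique. now apply is_derive_eval_r.
  - now apply is_derive_eval_r.
Qed.

(** In the plane Euler's relation forces the Hessian of a 1-homogeneous
    function to be a multiple [k] of the square of [w |-> w1 * v - w2 * u]. *)
Lemma hessian_posdef_square_iff (F : R -> R -> R) (e : expr) (u v k : R) :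
  (u, v) <> (0, 0) ->
  (forall s t, (s, t) <> (0, 0) -> F s t = eval q e s t) ->
  0 < eval q e u v ->
  eval q (diff q 1 0 e) u v * u + eval q (diff q 0 1 e) u v * v = eval q e u v ->
  eval q (diff q 1 0 (diff q 1 0 e)) u v = k * v ^ 2 ->
  eval q (diff q 1 0 (diff q 0 1 e)) u v = - k * (u * v) ->
  eval q (diff q 0 1 (diff q 0 1 e)) u v = k * u ^ 2 ->
  hessian_posdef (fun s t => F s t ^ 2) u v <-> 0 < k.
Proof.
  intros Hn HF Hpos Heul H20 H11 H02.
  assert (Hloc : locally_2d (fun s t => F s t ^ 2 = eval q (Times e e) s t) u v).
  { apply nonorigin_loc; [exact Hn|]. intros s t Hst. rewrite (HF _ _ Hst). simpl. ring. }
  unfold hessian_posdef.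
  rewrite !(partial_derive_ext_loc _ _ _ _ _ _ Hloc).
  rewrite (partial_derive_eval_20 _ _ _ Hn), (partial_derive_eval_11 _ _ _ Hn),
    (partial_derive_eval_02 _ _ _ Hn).
  cbn [diff eval]. rewrite H20, H11, H02.
  set (E := eval q e u v) in *.
  set (E1 := eval q (diff q 1 0 e) u v) in *.
  set (E2 := eval q (diff q 0 1 e) u v) in *.
  (* The Hessian of a square is twice the function times its Hessian plus twice the square of its
     differential. *)
  assert (Hform : forall w1 w2,
    (k * v ^ 2 * E + E1 * E1 + (E1 * E1 + E * (k * v ^ 2))) * w1 ^ 2 +
    2 * (- k * (u * v) * E + E2 * E1 + (E1 * E2 + E * (- k * (u * v)))) * (w1 * w2) +
    (k * u ^ 2 * E + E2 * E2 + (E2 * E2 + E * (k * u ^ 2))) * w2 ^ 2 =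
    2 * (E * k * (w1 * v - w2 * u) ^ 2 + (E1 * w1 + E2 * w2) ^ 2)) by (intros; ring).
  split.
  - intros H.
    (* This vector is annihilated by the differential, and Euler's relation gives
       [w1 * v - w2 * u = - E], so the form equals [2 * k * E ^ 3] there. *)
    assert (Hw : (- E2, E1) <> (0, 0)) by (intros Hw; injection Hw; nra).
    specialize (H _ _ Hw). rewrite Hform in H.
    replace (- E2 * v - E1 * u) with (- E) in H by lra.
    replace (E1 * - E2 + E2 * E1) with 0 in H by ring.
    assert (0 < E ^ 3) by now apply pow_lt. nra.
  - intros Hk w1 w2 Hw. rewrite Hform.
    assert (HEk : 0 < E * k) by now apply Rmult_lt_0_compat.
    (* On a nonzero [w] parallel to [(u, v)] the first square vanishes, but by Euler's relation the
       differential does not. *)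
    destruct (Req_dec (w1 * v - w2 * u) 0) as [H0|H0].
    + rewrite H0.
      assert (Hg : E1 * w1 + E2 * w2 <> 0).
      { intros H1. apply Hw.
        assert (E * w1 = 0).
        { rewrite <- Heul.
          transitivity (u * (E1 * w1 + E2 * w2) + E2 * (w1 * v - w2 * u)); [ring|].
          rewrite H0, H1; ring. }
        assert (E * w2 = 0).
        { rewrite <- Heul.
          transitivity (v * (E1 * w1 + E2 * w2) - E1 * (w1 * v - w2 * u)); [ring|].
          rewrite H0, H1; ring. }
        f_equal; nra. }
      apply pow2_gt_0 in Hg. nra.
    + apply pow2_gt_0 in H0. assert (H2 := pow2_ge_0 (E1 * w1 + E2 * w2)). nra.
Qed.

End Expressions.

(** * Convexity criterion for functions of the shape of [F] *)

Definition rational_expr (c l g1 g2 b1 b2 m1 m2 : R) : expr :=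
  Times (Const c)
    (Plus (Plus (Times (Const l) Root) (linear g1 g2))
          (Times (Times (linear b1 b2) (linear m1 m2)) InvRoot)).

(** [det q] times the inner product of [b] and [m] dual to [q]. *)
Definition dual_polar (q : qform) (b1 b2 m1 m2 : R) : R :=
  q22 q * (b1 * m1) - q12 q * (b1 * m2 + b2 * m1) + q11 q * (b2 * m2).

(** The numerator over [S^5] in the Hessian of [l S + B M / S]: the root contributes [l * qdet q],
    the quotient the remaining terms. In the Randers case it is [A] times the form [R]. *)
Definition convexity_form (q : qform) (l b1 b2 m1 m2 : R) : qform :=
  let s := l * qdet q + 2 * dual_polar q b1 b2 m1 m2 in
  QForm (s * q11 q - 3 * qdet q * (b1 * m1))
        (s * q12 q - 3 * qdet q * (b1 * m2 + b2 * m1) / 2)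
        (s * q22 q - 3 * qdet q * (b2 * m2)).

(** Homogeneity and smoothness come from the shape of the expression and positivity is assumed, so
    only convexity is left to decide. The origin is treated apart, since [InvRoot] has no meaning
    there. *)
Lemma minkowski_norm_rational_iff (q : qform) (c l g1 g2 b1 b2 m1 m2 : R)
    (F : R -> R -> R) :
  let e := rational_expr c l g1 g2 b1 b2 m1 m2 in
  qpos q -> 0 < c ->
  (forall u v, (u, v) <> (0, 0) -> F u v = eval q e u v) ->
  F 0 0 = 0 ->
  (forall u v, (u, v) <> (0, 0) -> 0 < eval q e u v) ->
  minkowski_norm F <-> qpos (convexity_form q l b1 b2 m1 m2).
Proof.
  intros e Hq Hc HF HF0 Hpos.
  assert (Hhess : forall u v, (u, v) <> (0, 0) ->
    hessian_posdef (fun s t => F s t ^ 2) u v <->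
    0 < qeval (convexity_form q l b1 b2 m1 m2) u v).
  { intros u v Hn.
    pose proof (sqrt_qeval_pos q Hq _ _ Hn) as Hs.
    set (i := / sqrt (qeval q u v)).
    assert (Hi : 0 < i) by now apply Rinv_0_lt_compat.
    assert (HS : sqrt (qeval q u v) = qeval q u v * i).
    { unfold i. rewrite <- (sqrt_sqrt (qeval q u v)) at 2 by now apply Rlt_le, Hq.
      field. lra. }
    assert (Hi2 : qeval q u v * i * i = 1).
    { rewrite <- HS. unfold i. field. lra. }
    (* Since [q * i^2 = 1], all terms can be raised to the common power [i^5]; each Hessian entry
       then becomes a polynomial identity in [u] and [v]. *)
    assert (Hdeg : forall X Y Z, X * i + Y * i ^ 3 + Z * i ^ 5 =
      (X * qeval q u v ^ 2 + Y * qeval q u v + Z) * i ^ 5).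
    { intros X Y Z.
      transitivity (X * i * (qeval q u v * i * i) ^ 2
                    + Y * i ^ 3 * (qeval q u v * i * i) + Z * i ^ 5).
      - rewrite Hi2. ring.
      - ring. }
    rewrite (hessian_posdef_square_iff q Hq F e u v
      (c * i ^ 5 * qeval (convexity_form q l b1 b2 m1 m2) u v) Hn HF).
    - assert (0 < c * i ^ 5) by (apply Rmult_lt_0_compat; [lra | now apply pow_lt]).
      split; intros H0.
      + apply Rmult_lt_reg_l with (c * i ^ 5); lra.
      + now apply Rmult_lt_0_compat.
    - now apply Hpos.
    - cbn -[sqrt qeval pow]. fold i. rewrite HS. apply Rminus_diag_uniq.
      transitivity (c * (b1 * u + b2 * v) * (m1 * u + m2 * v) * i
                    * (1 - qeval q u v * i * i)).
      + unfold qeval. ring.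
      + rewrite Hi2. ring.
    - cbn -[sqrt qeval pow]. fold i.
      (* The second derivative sorted by odd powers of [i], ready for [Hdeg]; the other two entries
         follow the same pattern. *)
      transitivity (c *
        ((l * q11 q + b1 * m1 + b1 * m1) * i
         + (- (l * ((q11 q * u + q12 q * v) * (q11 q * u + q12 q * v))
            + (b1 * (m1 * u + m2 * v) + m1 * (b1 * u + b2 * v)) * (q11 q * u + q12 q * v)
            + (b1 * (m1 * u + m2 * v) + m1 * (b1 * u + b2 * v)) * (q11 q * u + q12 q * v)
            + (b1 * u + b2 * v) * (m1 * u + m2 * v) * q11 q)) * i ^ 3
         + (3 * (b1 * u + b2 * v) * (m1 * u + m2 * v) * ((q11 q * u + q12 q * v) * (q11 q * u + q12 q * v))) * i ^ 5)).
      + ring.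
      + rewrite Hdeg. unfold qeval, convexity_form, dual_polar, qdet; cbn [q11 q12 q22]. field.
    - cbn -[sqrt qeval pow]. fold i.
      transitivity (c *
        ((l * q12 q + b1 * m2 + b2 * m1) * i
         + (- (l * ((q11 q * u + q12 q * v) * (q12 q * u + q22 q * v))
            + (b1 * (m1 * u + m2 * v) + m1 * (b1 * u + b2 * v)) * (q12 q * u + q22 q * v)
            + (b2 * (m1 * u + m2 * v) + m2 * (b1 * u + b2 * v)) * (q11 q * u + q12 q * v)
            + (b1 * u + b2 * v) * (m1 * u + m2 * v) * q12 q)) * i ^ 3
         + (3 * (b1 * u + b2 * v) * (m1 * u + m2 * v) * ((q11 q * u + q12 q * v) * (q12 q * u + q22 q * v))) * i ^ 5)).
      + ring.
      + rewrite Hdeg. unfold qeval, convexity_form, dual_polar, qdet; cbn [q11 q12 q22]. field.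
    - cbn -[sqrt qeval pow]. fold i.
      transitivity (c *
        ((l * q22 q + b2 * m2 + b2 * m2) * i
         + (- (l * ((q12 q * u + q22 q * v) * (q12 q * u + q22 q * v))
            + (b2 * (m1 * u + m2 * v) + m2 * (b1 * u + b2 * v)) * (q12 q * u + q22 q * v)
            + (b2 * (m1 * u + m2 * v) + m2 * (b1 * u + b2 * v)) * (q12 q * u + q22 q * v)
            + (b1 * u + b2 * v) * (m1 * u + m2 * v) * q22 q)) * i ^ 3
         + (3 * (b1 * u + b2 * v) * (m1 * u + m2 * v) * ((q12 q * u + q22 q * v) * (q12 q * u + q22 q * v))) * i ^ 5)).
      + ring.
      + rewrite Hdeg. unfold qeval, convexity_form, dual_polar, qdet; cbn [q11 q12 q22]. field. }
  assert (Hscale : forall a u v, 0 < a -> (u, v) <> (0, 0) ->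
    F (a * u) (a * v) = a * F u v).
  { intros a u v Ha Hn.
    assert (Hn' : (a * u, a * v) <> (0, 0)).
    { intros E. injection E as E1 E2. apply Hn. f_equal; nra. }
    rewrite (HF _ _ Hn), (HF _ _ Hn').
    unfold e, rational_expr, linear. cbn [eval].
    replace (qeval q (a * u) (a * v)) with (a ^ 2 * qeval q u v) by (unfold qeval; ring).
    rewrite sqrt_mult, sqrt_pow2 by (try apply pow2_ge_0; apply Rlt_le; auto).
    pose proof (sqrt_qeval_pos q Hq _ _ Hn). field. split; lra. }
  split.
  - intros Hmin u v Hn. apply Hhess; [exact Hn|].
    now apply (minkowski_convex _ Hmin).
  - intros HR. split.
    + intros u v. destruct (Req_dec u 0) as [->|Hu]; [destruct (Req_dec v 0) as [->|Hv]|].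
      * rewrite HF0. lra.
      * rewrite HF by congruence. apply Rlt_le, Hpos. congruence.
      * rewrite HF by congruence. apply Rlt_le, Hpos. congruence.
    + intros u v. split.
      * intros H0. destruct (Req_dec u 0) as [->|Hu]; [destruct (Req_dec v 0) as [->|Hv]|].
        -- reflexivity.
        -- assert (Hn : (0, v) <> (0, 0)) by congruence.
           specialize (Hpos _ _ Hn). rewrite (HF _ _ Hn) in H0. lra.
        -- assert (Hn : (u, v) <> (0, 0)) by congruence.
           specialize (Hpos _ _ Hn). rewrite (HF _ _ Hn) in H0. lra.
      * intros E. injection E as -> ->. exact HF0.
    + intros a u v Ha.
      destruct (Req_dec u 0) as [->|Hu]; [destruct (Req_dec v 0) as [->|Hv]|].
      * rewrite !Rmult_0_r, HF0. ring.
      * now apply Hscale; [|congruence].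
      * now apply Hscale; [|congruence].
    + intros n u v Hn. apply (ex_diff_n_ext_loc (eval q e)).
      * apply nonorigin_loc; [exact Hn|]. intros s t Hst. symmetry. now apply HF.
      * now apply smooth_eval.
    + intros u v Hn. apply Hhess; [exact Hn|]. now apply HR.
Qed.

(** Relative to [q], the form [r] has two eigenvalues of equal sign, and the trace makes them
    positive. Without diagonalising: [q11 r] times the trace is [qeval q (- q12 r) (q11 r) + q11 q *
    qdet r], which is positive. *)
Lemma qpos_of_trace (q r : qform) :
  qpos q -> 0 < qdet r ->
  0 < q22 q * q11 r - 2 * q12 q * q12 r + q11 q * q22 r -> qpos r.
Proof.
  intros Hq Hd Ht. apply qpos_iff. split; [|exact Hd].
  assert (H1 : 0 < q11 q) by now apply qpos_iff.
  assert (H2 : 0 <= qeval q (- q12 r) (q11 r)).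
  { destruct (Req_dec (q11 r) 0) as [H0|H0].
    - rewrite H0. unfold qeval. assert (H3 := pow2_ge_0 (- q12 r)). nra.
    - apply Rlt_le, Hq. congruence. }
  assert (H3 : q11 r * (q22 q * q11 r - 2 * q12 q * q12 r + q11 q * q22 r) =
               qeval q (- q12 r) (q11 r) + q11 q * qdet r)
    by (unfold qeval, qdet; ring).
  assert (0 < q11 q * qdet r) by now apply Rmult_lt_0_compat.
  apply Rmult_lt_reg_r with (q22 q * q11 r - 2 * q12 q * q12 r + q11 q * q22 r); lra.
Qed.

(** * Explicit formulas for [P] and [F] in the Randers case *)

Definition discr (a x1 x2 : R) : R := (1 - a * x1) ^ 2 - (x1 ^ 2 + x2 ^ 2).

Definition root_form (a x1 x2 : R) : qform :=
  QForm (1 - (1 - a ^ 2) * x2 ^ 2)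
        ((a + (1 - a ^ 2) * x1) * x2)
        (1 - 2 * a * x1 - (1 - a ^ 2) * x1 ^ 2).

(** Squaring [p = |y + p x| + a (y1 + p x1)] gives a quadratic equation for [p]
    with leading coefficient [discr], and [p = solP] is its larger root, in
    which [root_form] is a quarter of the discriminant. *)
Definition solP_expr (a x1 x2 : R) : expr :=
  Times (Const (/ discr a x1 x2)) (Plus Root (linear (a + (1 - a ^ 2) * x1) x2)).

(** Here [b] is the coefficient vector of [B] and [m] that of [M]; the linear term has coefficients
    [l b + m], written out. *)
Definition metricF_expr (a x1 x2 : R) : expr :=
  rational_expr (/ discr a x1 x2 ^ 2) (1 - a * x1)
    ((1 - a * x1) * (a + (1 - a ^ 2) * x1) + (x1 + a * x2 ^ 2))
    ((1 - a * x1) * x2 + (1 - a * x1) * x2)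
    (a + (1 - a ^ 2) * x1) x2
    (x1 + a * x2 ^ 2) ((1 - a * x1) * x2).

Definition convexity_discr (a x1 x2 : R) : R :=
  (2 + a * x1) ^ 2 - (9 * a ^ 2 - 8) * (x1 ^ 2 + x2 ^ 2).

Lemma add_pos_of_sqr_lt (S t : R) : 0 < S -> 0 < S * S - t * t -> 0 < S + t.
Proof. intros H H0. nra. Qed.

(** * Positivity, the fixed point and the metric at a point of [Omega] *)

Section Randers.

Context (a x1 x2 : R) (ha : 0 <= a < 1) (hx : Omega (randers a 0) x1 x2).

Let l := 1 - a * x1.
Let A := discr a x1 x2.
Let b1 := a + (1 - a ^ 2) * x1.
Let m1 := x1 + a * x2 ^ 2.
Let q := root_form a x1 x2.

Lemma norm_x_lt : sqrt (x1 ^ 2 + x2 ^ 2) < l.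
Proof. unfold Omega, randers in hx. unfold l. lra. Qed.

Lemma l_pos : 0 < l.
Proof. pose proof norm_x_lt. pose proof (sqrt_pos (x1 ^ 2 + x2 ^ 2)). lra. Qed.

(** [A = (l - |x|) (l + |x|)], and membership in [Omega] means [|x| < l]. *)
Lemma discr_pos : 0 < A.
Proof.
  pose proof norm_x_lt as H. pose proof (sqrt_pos (x1 ^ 2 + x2 ^ 2)) as H0.
  assert (H1 : sqrt (x1 ^ 2 + x2 ^ 2) * sqrt (x1 ^ 2 + x2 ^ 2) = x1 ^ 2 + x2 ^ 2)
    by (apply sqrt_sqrt; nra).
  unfold A, discr. fold l. nra.
Qed.

Lemma qdet_root_form : qdet q = A.
Proof. unfold qdet, q, root_form, A, discr; cbn [q11 q12 q22]. ring. Qed.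

Lemma qpos_root_form : qpos q.
Proof.
  pose proof discr_pos as HA. apply qpos_iff. rewrite qdet_root_form. split; [|exact HA].
  (* The value at [(1, 0)] of the decomposition [q = B^2 + A ((1 - a^2) u^2 + v^2)]. *)
  replace (q11 q) with (b1 ^ 2 + A * (1 - a ^ 2))
    by (unfold q, root_form, A, discr, b1; cbn [q11]; ring).
  assert (0 <= b1 ^ 2) by apply pow2_ge_0.
  assert (0 < A * (1 - a ^ 2)) by (apply Rmult_lt_0_compat; nra). lra.
Qed.

Lemma sqrt_root_form_sqr (u v : R) :
  sqrt (qeval q u v) * sqrt (qeval q u v) = qeval q u v.
Proof.
  apply sqrt_sqrt. destruct (Req_dec u 0) as [->|Hu]; [destruct (Req_dec v 0) as [->|Hv]|].
  - unfold qeval. lra.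
  - apply Rlt_le, qpos_root_form. congruence.
  - apply Rlt_le, qpos_root_form. congruence.
Qed.

(** The quantity is [A P]. It is positive since [q - B^2] is [A] times a positive definite form,
    whence [S > |B|]. *)
Lemma factor_b_pos (u v : R) :
  (u, v) <> (0, 0) -> 0 < sqrt (qeval q u v) + (b1 * u + x2 * v).
Proof.
  intros Hn. apply add_pos_of_sqr_lt; [exact (sqrt_qeval_pos q qpos_root_form _ _ Hn)|].
  rewrite sqrt_root_form_sqr.
  replace (qeval q u v - (b1 * u + x2 * v) * (b1 * u + x2 * v))
    with (A * ((1 - a ^ 2) * u ^ 2 + v ^ 2))
    by (unfold qeval, q, root_form, A, discr, b1; cbn [q11 q12 q22]; ring).
  apply Rmult_lt_0_compat; [exact discr_pos|].
  assert (He : 0 < 1 - a ^ 2) by nra.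
  destruct (Req_dec v 0) as [->|Hv].
  - assert (Hu : u <> 0) by congruence. apply pow2_gt_0 in Hu.
    pose proof (Rmult_lt_0_compat _ _ He Hu). lra.
  - apply pow2_gt_0 in Hv.
    pose proof (Rmult_le_pos _ _ (Rlt_le _ _ He) (pow2_ge_0 u)). lra.
Qed.

(** With [y = (u, v)] the right side is [A |l y + a y1 x|^2]; its first component reduces to [y1],
    so it vanishes only at [y = 0]. *)
Lemma factor_m_identity (u v : R) :
  (l ^ 2 * qeval q u v - (m1 * u + l * x2 * v) ^ 2) =
  A * ((l * u + a * u * x1) ^ 2 + (l * v + a * u * x2) ^ 2).
Proof. unfold qeval, q, root_form, A, discr, m1, l; cbn [q11 q12 q22]. ring. Qed.

(** The quantity is [A |y + x P|]. Its sign selects the correct root of the squared equation and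
    later gives [F > 0]. *)
Lemma factor_m_pos (u v : R) :
  (u, v) <> (0, 0) -> 0 < l * sqrt (qeval q u v) + (m1 * u + l * x2 * v).
Proof.
  intros Hn. pose proof l_pos as Hl.
  apply add_pos_of_sqr_lt.
  - apply Rmult_lt_0_compat; [exact Hl|]. exact (sqrt_qeval_pos q qpos_root_form _ _ Hn).
  - replace (l * sqrt (qeval q u v) * (l * sqrt (qeval q u v)))
      with (l ^ 2 * (sqrt (qeval q u v) * sqrt (qeval q u v))) by ring.
    rewrite sqrt_root_form_sqr.
    replace ((m1 * u + l * x2 * v) * (m1 * u + l * x2 * v))
      with ((m1 * u + l * x2 * v) ^ 2) by ring.
    rewrite factor_m_identity. apply Rmult_lt_0_compat; [exact discr_pos|].
    replace (l * u + a * u * x1) with u by (unfold l; ring).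
    destruct (Req_dec u 0) as [->|Hu].
    + assert (Hv : v <> 0) by congruence.
      replace (0 ^ 2 + (l * v + a * 0 * x2) ^ 2) with ((l * v) ^ 2) by ring.
      apply pow2_gt_0. now apply Rmult_integral_contrapositive; split; [lra|].
    + apply pow2_gt_0 in Hu. assert (H := pow2_ge_0 (l * v + a * u * x2)). lra.
Qed.

Lemma solP_expr_solves (y1 y2 : R) :
  let p := eval q (solP_expr a x1 x2) y1 y2 in
  p = randers a 0 (y1 + x1 * p) (y2 + x2 * p).
Proof.
  intros p. pose proof discr_pos as HA.
  set (S := sqrt (qeval q y1 y2)).
  assert (Hp : A * p = S + (b1 * y1 + x2 * y2)).
  { unfold p, solP_expr, linear. cbn [eval]. fold S A b1. field. lra. }
  assert (HS : S * S = qeval q y1 y2) by apply sqrt_root_form_sqr.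
  assert (Hn : A * (l * p - a * y1) = l * S + (m1 * y1 + l * x2 * y2)).
  { replace (A * (l * p - a * y1)) with (l * (A * p) - A * a * y1) by ring.
    rewrite Hp. unfold A, discr, b1, m1, l. ring. }
  (* Squaring loses the sign of [l p - a y1], which has to equal the norm [|y + x p|]. *)
  assert (Hn0 : 0 <= l * p - a * y1).
  { apply Rmult_le_reg_l with A; [exact HA|]. rewrite Hn, Rmult_0_r.
    destruct (Req_dec y1 0) as [H1|H1]; [destruct (Req_dec y2 0) as [H2|H2]|].
    - rewrite H1, H2. pose proof l_pos. pose proof (sqrt_pos (qeval q y1 y2)). fold S in H0.
      nra.
    - apply Rlt_le, factor_m_pos. congruence.
    - apply Rlt_le, factor_m_pos. congruence. }
  unfold randers.
  replace ((y1 + x1 * p) ^ 2 + (y2 + x2 * p) ^ 2) with ((l * p - a * y1) ^ 2).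
  - rewrite sqrt_pow2 by exact Hn0. unfold l. ring.
  (* Multiplied by [A], the squared equation reads [(A p - B)^2 = q]. *)
  - apply Rmult_eq_reg_l with A; [|lra]. apply Rminus_diag_uniq.
    transitivity ((A * p - (b1 * y1 + x2 * y2)) ^ 2 - qeval q y1 y2).
    + unfold A, discr, l, b1, q, root_form, qeval; cbn [q11 q12 q22]. ring.
    + rewrite Hp, <- HS. ring.
Qed.

(** If [p' < p], subadditivity of [phi] gives [p - p' <= (p - p') * phi x],
    contradicting [phi x < 1]. *)
Lemma randers_fixpoint_le (y1 y2 p p' : R) :
  p = randers a 0 (y1 + x1 * p) (y2 + x2 * p) ->
  p' = randers a 0 (y1 + x1 * p') (y2 + x2 * p') -> p <= p'.
Proof.
  intros Hp Hp'. apply Rnot_lt_le. intros Hlt.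
  assert (Htri : sqrt ((y1 + x1 * p) ^ 2 + (y2 + x2 * p) ^ 2) <=
    sqrt ((y1 + x1 * p') ^ 2 + (y2 + x2 * p') ^ 2) + (p - p') * sqrt (x1 ^ 2 + x2 ^ 2)).
  { pose proof (Cmod_triangle (y1 + x1 * p', y2 + x2 * p')
      ((p - p') * x1, (p - p') * x2)) as H.
    unfold Cmod in H; cbn [fst snd Cplus] in H.
    replace (((p - p') * x1) ^ 2 + ((p - p') * x2) ^ 2)
      with ((p - p') ^ 2 * (x1 ^ 2 + x2 ^ 2)) in H by ring.
    rewrite sqrt_mult, sqrt_pow2 in H by nra.
    replace (y1 + x1 * p) with (y1 + x1 * p' + (p - p') * x1) by ring.
    replace (y2 + x2 * p) with (y2 + x2 * p' + (p - p') * x2) by ring.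
    exact H. }
  unfold randers in Hp, Hp'.
  pose proof norm_x_lt as Hx. unfold l in Hx. nra.
Qed.

Lemma solP_randers (y1 y2 : R) :
  solP (randers a 0) x1 x2 y1 y2 = eval q (solP_expr a x1 x2) y1 y2.
Proof.
  unfold solP. apply (@iota_unique _ R_CompleteNormedModule).
  - intros p Hp. pose proof (solP_expr_solves y1 y2) as Hs.
    apply Rle_antisym; eapply randers_fixpoint_le; eassumption.
  - apply solP_expr_solves.
Qed.

(** As [psi = phi], the fixed point equation turns the first factor into [P = (S + B) / A]. The
    second is [(l S + M) / (A S)], because [A + B x = l] and the derivative of [S] along [x] is
    [M / S]. *)
Lemma metricF_randers (y1 y2 : R) :
  (y1, y2) <> (0, 0) ->
  metricF (randers a 0) (randers a 0) x1 x2 y1 y2 = eval q (metricF_expr a x1 x2) y1 y2.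
Proof.
  intros Hn. pose proof qpos_root_form as Hq. pose proof discr_pos as HA.
  unfold metricF. cbv zeta.
  rewrite (Derive_ext (fun t => solP (randers a 0) x1 x2 t y2)
             (fun t => eval q (solP_expr a x1 x2) t y2))
    by (intros; apply solP_randers).
  rewrite (Derive_ext (fun t => solP (randers a 0) x1 x2 y1 t)
             (fun t => eval q (solP_expr a x1 x2) y1 t))
    by (intros; apply solP_randers).
  rewrite (is_derive_unique _ _ _ (is_derive_eval_l q Hq _ _ _ Hn)).
  rewrite (is_derive_unique _ _ _ (is_derive_eval_r q Hq _ _ _ Hn)).
  rewrite solP_randers, <- solP_expr_solves.
  pose proof (sqrt_qeval_pos q Hq _ _ Hn) as Hs.
  unfold solP_expr, metricF_expr, rational_expr, linear. cbn -[sqrt qeval pow discr q].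
  fold A. set (S := sqrt (qeval q y1 y2)) in *.
  transitivity (/ A ^ 2 * / S * (S + (b1 * y1 + x2 * y2))
                * ((A + b1 * x1 + x2 * x2) * S
                   + ((q11 q * x1 + q12 q * x2) * y1 + (q12 q * x1 + q22 q * x2) * y2))).
  - unfold b1. field. split; lra.
  - replace (A + b1 * x1 + x2 * x2) with l by (unfold A, discr, b1, l; ring).
    replace (q11 q * x1 + q12 q * x2) with m1
      by (unfold m1, q, root_form; cbn [q11 q12]; ring).
    replace (q12 q * x1 + q22 q * x2) with (l * x2)
      by (unfold l, q, root_form; cbn [q22 q12]; ring).
    unfold b1, m1, l. field. split; lra.
Qed.

Lemma metricF_randers_0 : metricF (randers a 0) (randers a 0) x1 x2 0 0 = 0.
Proof.
  unfold metricF. cbv zeta. rewrite solP_randers, <- solP_expr_solves.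
  unfold solP_expr, linear; cbn [eval].
  replace (qeval q 0 0) with 0 by (unfold qeval; ring). rewrite sqrt_0. ring.
Qed.

Lemma metricF_expr_pos (y1 y2 : R) :
  (y1, y2) <> (0, 0) -> 0 < eval q (metricF_expr a x1 x2) y1 y2.
Proof.
  intros Hn. pose proof discr_pos as HA.
  pose proof (sqrt_qeval_pos q qpos_root_form _ _ Hn) as Hs.
  replace (eval q (metricF_expr a x1 x2) y1 y2) with
    (/ (A ^ 2 * sqrt (qeval q y1 y2)) * ((sqrt (qeval q y1 y2) + (b1 * y1 + x2 * y2))
     * (l * sqrt (qeval q y1 y2) + (m1 * y1 + l * x2 * y2)))).
  - apply Rmult_lt_0_compat.
    + apply Rinv_0_lt_compat, Rmult_lt_0_compat; [now apply pow_lt|exact Hs].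
    + apply Rmult_lt_0_compat; [now apply factor_b_pos|now apply factor_m_pos].
  - unfold metricF_expr, rational_expr, linear. cbn [eval]. fold A.
    unfold b1, m1, l. field. split; lra.
Qed.

Lemma qpos_convexity_form_iff :
  qpos (convexity_form q l b1 x2 m1 (l * x2)) <-> 0 < convexity_discr a x1 x2.
Proof.
  pose proof discr_pos as HA.
  (* Hence the coefficient of [q] in [convexity_form] is [A (3 l - 2 A)]. *)
  assert (Hdual : dual_polar q b1 x2 m1 (l * x2) = A * (l - A)).
  { unfold dual_polar, q, root_form, A, discr, b1, m1, l; cbn [q11 q12 q22]. ring. }
  assert (Hdet : qdet (convexity_form q l b1 x2 m1 (l * x2)) =
                 A ^ 4 / 4 * convexity_discr a x1 x2).
  { unfold qdet, convexity_form; cbn [q11 q12 q22]. rewrite Hdual, qdet_root_form.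
    unfold q, root_form, A, discr, b1, m1, l, convexity_discr; cbn [q11 q12 q22]. field. }
  assert (HA4 : 0 < A ^ 4 / 4) by (pose proof (pow_lt A 4 HA); lra).
  split.
  - intros H. apply qpos_iff in H. destruct H as [_ H]. rewrite Hdet in H.
    apply Rmult_lt_reg_l with (A ^ 4 / 4); lra.
  - intros H. apply (qpos_of_trace q).
    + exact qpos_root_form.
    + rewrite Hdet. now apply Rmult_lt_0_compat.
    + replace (q22 q * _ - _ + _) with (A ^ 2 * (3 * l - A)).
      * assert (3 * l - A = l + 1 + (1 - a ^ 2) * x1 ^ 2 + x2 ^ 2)
          by (unfold A, discr, l; ring).
        pose proof l_pos. pose proof (pow2_ge_0 x1). pose proof (pow2_ge_0 x2).
        assert (0 < A ^ 2) by now apply pow_lt.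
        assert (0 <= (1 - a ^ 2) * x1 ^ 2) by (apply Rmult_le_pos; nra).
        apply Rmult_lt_0_compat; lra.
      * unfold convexity_form; cbn [q11 q12 q22]. rewrite Hdual, qdet_root_form.
        unfold q, root_form, A, discr, b1, m1, l; cbn [q11 q12 q22]. field.
Qed.

Lemma minkowski_norm_metricF_iff :
  minkowski_norm (metricF (randers a 0) (randers a 0) x1 x2) <->
  0 < convexity_discr a x1 x2.
Proof.
  rewrite <- qpos_convexity_form_iff.
  apply minkowski_norm_rational_iff with
    (c := / A ^ 2) (g1 := l * b1 + m1) (g2 := l * x2 + l * x2).
  - exact qpos_root_form.
  - apply Rinv_0_lt_compat, pow_lt, discr_pos.
  - exact metricF_randers.
  - exact metricF_randers_0.
  - exact metricF_expr_pos.
Qed.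

End Randers.

(** * The three configurations *)

Lemma minkowski_locus_randers_iff (a x1 x2 : R) :
  0 <= a < 1 ->
  minkowski_locus (randers a 0) (randers a 0) x1 x2 <->
  Omega (randers a 0) x1 x2 /\ 0 < convexity_discr a x1 x2.
Proof.
  intros ha. unfold minkowski_locus. split; intros [hx H]; split; try exact hx.
  - now apply (minkowski_norm_metricF_iff a x1 x2 ha hx).
  - now apply (minkowski_norm_metricF_iff a x1 x2 ha hx).
Qed.

Theorem proposition3p12 (a1 : R) (ha : 0 <= a1 < 1) :
  let psi := randers a1 0 in
  let phi := randers a1 0 in
  (a1 < 2 * sqrt 2 / 3 ->
    forall x1 x2 : R, minkowski_locus psi phi x1 x2 <-> Omega phi x1 x2)
  /\
  (a1 = 2 * sqrt 2 / 3 ->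
    forall x1 x2 : R, minkowski_locus psi phi x1 x2 <->
      (Omega phi x1 x2 /\ ~ x1 = - (3 * sqrt 2 / 2)))
  /\
  (2 * sqrt 2 / 3 < a1 ->
    forall x1 x2 : R, minkowski_locus psi phi x1 x2 <->
      (Omega phi x1 x2 /\
       8 * (1 - a1 ^ 2) * (x1 + a1 / (4 * (1 - a1 ^ 2))) ^ 2
         - (9 * a1 ^ 2 - 8) * x2 ^ 2
       > (9 * a1 ^ 2 - 8) / (2 * (1 - a1 ^ 2)))).
Proof.
  cbv zeta.
  assert (Hs : sqrt 2 * sqrt 2 = 2) by (apply sqrt_sqrt; lra).
  assert (Hs0 : 0 < sqrt 2) by (apply sqrt_lt_R0; lra).
  split; [|split]; intros Ha x1 x2; rewrite (minkowski_locus_randers_iff a1 x1 x2 ha).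
  - split; [tauto|]. intros hx. split; [exact hx|]. unfold convexity_discr.
    assert (H9 : 9 * a1 ^ 2 < 8) by nra.
    assert (H2 := pow2_ge_0 (2 + a1 * x1)).
    assert (H3 := pow2_ge_0 x2). assert (H4 := pow2_ge_0 x1).
    (* If [x1 = 0] the leading square is 4; otherwise [(8 - 9 a1^2) x1^2] is strictly positive. *)
    destruct (Req_dec x1 0) as [->|H1].
    + nra.
    + apply pow2_gt_0 in H1. nra.
  (* At the critical value the discriminant is the square of [2 + a1 x1], which vanishes exactly on
     the line [x1 = - 2 / a1]. *)
  - assert (H9 : 9 * a1 ^ 2 - 8 = 0) by (rewrite Ha; nra).
    assert (H2 : convexity_discr a1 x1 x2 = (2 + a1 * x1) ^ 2)
      by (unfold convexity_discr; rewrite H9; ring).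
    assert (H3 : 2 + a1 * x1 = 2 * sqrt 2 / 3 * (x1 + 3 * sqrt 2 / 2))
      by (rewrite Ha; nra).
    rewrite H2, H3. split; intros [hx H]; split; try exact hx.
    + intros H1. rewrite H1 in H. replace (- (3 * sqrt 2 / 2) + 3 * sqrt 2 / 2) with 0 in H by ring.
      lra.
    + apply pow2_gt_0. apply Rmult_integral_contrapositive. lra.
  - assert (He : 1 - a1 ^ 2 <> 0) by nra.
    (* Completing the square in [x1], whose leading coefficient is
       [a1^2 - (9 a1^2 - 8) = 8 (1 - a1^2)]. *)
    assert (H2 : convexity_discr a1 x1 x2 =
      8 * (1 - a1 ^ 2) * (x1 + a1 / (4 * (1 - a1 ^ 2))) ^ 2
         - (9 * a1 ^ 2 - 8) * x2 ^ 2 - (9 * a1 ^ 2 - 8) / (2 * (1 - a1 ^ 2)))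
      by (unfold convexity_discr; field; exact He).
    rewrite H2. split; intros [hx H]; split; try exact hx; lra.
Qed.
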